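(* Let $(\mathbb{S},\Sigma)$ be a measurable space, $\mu\in\mathcal{M}(\mathbb{S})$, and $\{f,f^{(n)}\}_{n=1,2,\ldots}\subset L^1(\mathbb{S};\mu)$. Then the inequality $$\liminf_{n\to\infty}\ \inf_{S\in\Sigma}\left(\int_S f^{(n)}(s)\,\mu(ds)-\int_S f(s)\,\mu(ds)\right)\ge 0$$ holds if and only if the following two statements hold: (i) for each $\varepsilon>0$, $$\mu(\{s\in\mathbb{S}: f^{(n)}(s)\le f(s)-\varepsilon\})\to 0\quad\text{as } n\to\infty,$$ and, therefore (as a consequence of this convergence), there exists a subsequence $\{f^{(n_k)}\}_{k=1,2,\ldots}$ of $\{f^{(n)}\}_{n=1,2,\ldots}$ such that $\liminf_{k\to\infty} f^{(n_k)}(s)\ge f(s)$ for $\mu$-a.e. $s\in\mathbb{S}$; (ii) $$\liminf_{K\to+\infty}\ \inf_{n=1,2,\ldots}\int_{\{s\in\mathbb{S}:\, f^{(n)}(s)\le -K\}} f^{(n)}(s)\,\mu(ds)\ge 0.$$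
   Context: $\mathcal{M}(\mathbb{S})$ is the family of finite (nonnegative) measures on $(\mathbb{S},\Sigma)$. Functions $f:\mathbb{S}\to\overline{\mathbb{R}}:=\mathbb{R}\cup\{\pm\infty\}$ are called measurable if $\{s\in\mathbb{S}: f(s)<\alpha\}\in\Sigma$ for each $\alpha\in\mathbb{R}$. $L^1(\mathbb{S};\mu)$ is the set of all measurable functions $g:\mathbb{S}\to\overline{\mathbb{R}}$ with $\int_{\mathbb{S}}|g(s)|\,\mu(ds)<+\infty$. *)

(* Defs.v *)
From mathcomp Require Import all_boot all_order all_algebra.
From mathcomp Require Import all_classical all_reals all_analysis.
Set Implicit Arguments.
Unset Strict Implicit.
Unset Printing Implicit Defensive.
Import Order.TTheory GRing.Theory Num.Theory.
Import numFieldNormedType.Exports.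

Local Open Scope classical_set_scope.
Local Open Scope ring_scope.
Local Open Scope ereal_scope.

(* A sequence g^(1), g^(2), ... is a function [g : nat -> _] in which [g n]
   stands for g^(n+1). *)

Definition lower_cvg_in_measure (R : realType) (d : measure_display)
    (T : measurableType d) (mu : {finite_measure set T -> \bar R})
    (fn : nat -> T -> \bar R) (f : T -> \bar R) : Prop :=
  forall e : R, (0 < e)%R ->
    mu [set s | fn n s <= f s - e%:E] @[n --> \oo] --> 0.

Definition has_subseq_liminf_ge (R : realType) (d : measure_display)
    (T : measurableType d) (mu : {finite_measure set T -> \bar R})
    (fn : nat -> T -> \bar R) (f : T -> \bar R) : Prop :=
  exists nk : nat -> nat,
    (forall i j : nat, (i < j)%N -> (nk i < nk j)%N) /\
    {ae mu, forall s, f s <= limn_einf (fun k : nat => fn (nk k) s)}.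

(* Main.v *)
Require Import Defs.
From mathcomp Require Import all_boot all_order all_algebra.
From mathcomp Require Import all_classical all_reals all_analysis.
From mathcomp Require Import lra measurable_realfun.
Import Order.TTheory GRing.Theory Num.Theory.
Import numFieldNormedType.Exports.

Set Implicit Arguments.
Unset Strict Implicit.
Unset Printing Implicit Defensive.

Local Open Scope classical_set_scope.
Local Open Scope ring_scope.
Local Open Scope ereal_scope.

(** Why the theorem is true.  Write [A = {g <= f - a}] and [B = {g <= -K}] for a
function [g] of the sequence.  The inequality says that, for every [e > 0], the
differences of the integrals of [g] and [f] over [S] are eventually bounded below
by [-e], uniformly in [S].

It implies lower convergence in measure: on [A] the integral of [g] is at most
that of [f] minus [a mu(A)], so a uniform lower bound [-e] forces
[mu(A) <= e/a].

It implies the tail condition ([near_tail_ge]): a Chebyshev estimate bounds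
[K mu(B)] by [e/2] plus the integral of [|f|], hence [mu(B)] is small for large
[K] whatever [g] is; by absolute continuity the integral of [f] over [B] is then
small, and the uniform lower bound with [S = B] passes this on to [g].  The
finitely many initial functions, for which the bound is not known, satisfy it
when compared with themselves in place of [f].

The converse ([rint_le_truncation]): [S] is cut into the part outside [A], where
[f] exceeds [g] by at most [a]; the part in [A] but outside [B], where [g] is at
least [-K] and the mass is at most [mu(A)]; and the part in [B], where the
integral of [g] is controlled by the tail.  One picks [a], then [K] from the tail
condition, then [n] from lower convergence in measure.

The subsequence ([lower_cvg_subseq]) is a Borel-Cantelli argument along levels
and masses that are summable.

Since an integrable function may be infinite on a null set, the estimates are
not obtained by subtracting functions pointwise: [f] and [g] are compared by
inequalities of the form [g <= f + c] on a set, with [c] real, and only the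
integrals, which are finite, are subtracted. *)

(** * Limits in the extended reals *)

(** A lower limit is a supremum of infima over the members of the filter, so a
bound on it is a bound along the filter, up to any loss [e]. *)
Lemma limf_einf_geP (R : realType) (T : choiceType) (X : filteredType T)
    (u : X -> \bar R) (F : set_system X) (FF : Filter F) (c : R) :
  c%:E <= limf_einf u F <->
  forall e : R, (0 < e)%R -> \forall x \near F, (c - e)%:E <= u x.
Proof.
rewrite limf_einfE; split => [cu e e0|cu].
  have : (c - e)%:E < ereal_sup [set ereal_inf (u @` V) | V in F].
    by apply: lt_le_trans cu; rewrite lte_fin; lra.
  move=> /ereal_sup_gt[_ [V FV <-]] /ltW ceV.
  apply: filterS FV => x Vx; apply: le_trans ceV _.
  by apply: ereal_inf_lbound; exists x.
apply/lee_subgt0Pr => e e0; rewrite -EFinB.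
apply: (@le_trans _ _ (ereal_inf (u @` [set x | (c - e)%:E <= u x]))).
  by apply: le_ereal_inf_tmp => _ [x xV <-].
by apply: ereal_sup_ubound; exists [set x | (c - e)%:E <= u x] => //; exact: cu.
Qed.

(** For nonnegative functions convergence to [0] needs only upper bounds. *)
Lemma cvge0P (R : realType) (X : Type) (F : set_system X) (FF : Filter F)
    (u : X -> \bar R) (u0 : forall x, 0 <= u x) :
  u @ F --> 0 <-> forall e : R, (0 < e)%R -> \forall x \near F, u x < e%:E.
Proof.
split=> [/fine_cvgP[ufin /cvgrPdist_lt u_0] e e0|ue].
  near=> x.
  have uf : u x \is a fin_num by near: x.
  have : (`|0 - fine (u x)| < e)%R by near: x; exact: u_0.
  by rewrite sub0r normrN ger0_norm ?fine_ge0// -lte_fin fineK.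
have ufin e x : u x < e%:E -> u x \is a fin_num.
  by move=> uxe; rewrite ge0_fin_numE// (lt_trans uxe)// ltry.
apply/fine_cvgP; split.
  by apply: filterS (ue _ ltr01) => x /ufin.
apply/cvgrPdist_lt => e e0; apply: filterS (ue _ e0) => x uxe.
rewrite sub0r normrN ger0_norm ?fine_ge0//= -lte_fin fineK//.
exact: ufin uxe.
Unshelve. all: by end_near. Qed.

(** * Integrals of an integrable function over measurable sets *)

Section integrals_over_sets.
Context (R : realType) (d : measure_display) (T : measurableType d).
Variable mu : {finite_measure set T -> \bar R}.
Implicit Types (f g : T -> \bar R) (A B D S : set T).

Local Notation integrableT f := (mu.-integrable [set: T] f).

(** Integrals and masses as real numbers, which is where the inequalities between
them are combined; [rintE] and [rmassE] say that nothing is lost. *)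
Definition rint f S : R := fine (\int[mu]_(s in S) f s).
Definition rmass S : R := fine (mu S).

Lemma integrable_on f S : integrableT f -> measurable S -> mu.-integrable S f.
Proof. by move=> fi mS; apply: integrableS fi. Qed.

Lemma rintE f S : integrableT f -> measurable S ->
  \int[mu]_(s in S) f s = (rint f S)%:E.
Proof.
by move=> fi mS; rewrite fineK//; apply: integrable_fin_num => //;
   exact: integrable_on.
Qed.

Lemma rmassE S : measurable S -> mu S = (rmass S)%:E.
Proof. by move=> mS; rewrite fineK//; exact: fin_num_measure. Qed.

Lemma rmass_ge0 S : (0 <= rmass S)%R.
Proof. exact: fine_ge0. Qed.

Lemma le_rmass A B : measurable A -> measurable B -> A `<=` B ->
  (rmass A <= rmass B)%R.
Proof.
by move=> mA mB AB; rewrite -lee_fin -!rmassE// le_measure// inE.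
Qed.

Lemma rint_setID f S A : integrableT f -> measurable S -> measurable A ->
  rint f S = (rint f (S `&` A) + rint f (S `\` A))%R.
Proof.
move=> fi mS mA; apply: EFin_inj.
have mSA := measurableI _ _ mS mA; have mSDA := measurableD mS mA.
rewrite EFinD -!rintE// -integral_setU//; first by rewrite setUIDK.
- by rewrite setUIDK; apply: measurable_int; exact: integrable_on.
- by apply/disj_setPS => s [[_ As] [_]].
Qed.

(** Taking [c] of either sign, or one of the functions zero, covers [g] below
[f - a], [f] below [g + a], and bounds by the level [-K]. *)
Lemma rint_le_shift f g D c : integrableT f -> integrableT g -> measurable D ->
  (forall s, D s -> g s <= f s + c%:E) ->
  (rint g D <= rint f D + c * rmass D)%R.
Proof.
move=> fi gi mD gf; rewrite -lee_fin EFinD EFinM -rmassE// -!rintE//.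
have ci := finite_measure_integrable_cst mu c mD.
rewrite -(integral_cst mu mD) -integralD//; last exact: integrable_on.
apply: le_integral => //; first exact: integrable_on.
  by apply: integrableD => //; exact: integrable_on.
by move=> s; rewrite inE => /gf.
Qed.

Lemma rint0 S : rint (cst 0) S = 0%R.
Proof. by rewrite /rint integral0. Qed.

Lemma rint_abs_le f S : integrableT f -> measurable S ->
  (`|rint f S| <= rint (abse \o f) S)%R.
Proof.
move=> fi mS; rewrite -lee_fin -abse_EFin -!rintE//; last exact: integrable_abse.
by apply: le_abse_integral => //; apply: measurable_int; exact: integrable_on.
Qed.

Lemma rint_abs_subset f A B : integrableT f -> measurable A -> measurable B ->
  A `<=` B -> (rint (abse \o f) A <= rint (abse \o f) B)%R.
Proof.
move=> fi mA mB AB; have afi := integrable_abse fi.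
rewrite -lee_fin -!rintE//; apply: ge0_subset_integral => //.
  by apply: measurable_int; exact: integrable_on.
by move=> s _; exact: abse_ge0.
Qed.

(** Absolute continuity of the integral.  The real-valued case carries over
because an integrable function agrees a.e. with its finite part. *)
Lemma rint_abs_continuous f e : integrableT f -> (0 < e)%R ->
  exists2 r : R, (0 < r)%R & forall A, measurable A -> (rmass A < r)%R ->
    (rint (abse \o f) A < e)%R.
Proof.
move=> fi e0.
have mf := measurable_int _ fi.
have mff : measurable_fun [set: T] (fine \o f : T -> R).
  exact: (@measurableT_comp _ _ _ T (\bar R) R (@fine R : \bar R -> R) _ f).
have ffi : integrableT (EFin \o (fine \o f)).
  apply: (le_integrable measurableT _ _ fi); first exact/measurable_EFinP.
  by move=> s _ /=; case: (f s) => //=; rewrite leey.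
have [r [r0 rP]] := integral_normr_continuous ffi e0.
exists r => // A mA Ar.
suff -> : rint (abse \o f) A = (\int[mu]_(s in A) `|fine (f s)|)%R.
  have {}Ar : mu A < r%:E by rewrite rmassE// lte_fin.
  exact: rP.
rewrite /rint /Rintegral; apply: (congr1 fine); apply: ae_eq_integral => //.
- by apply: measurable_funTS; exact: measurableT_comp mf.
- apply: measurable_funTS; apply/measurable_EFinP.
  exact: measurableT_comp mff.
- by apply: filterS (integrable_ae measurableT fi) => s /(_ I) + _ /=; case: (f s).
Qed.

Lemma measurable_le_shift f g (c : R) :
  measurable_fun [set: T] f -> measurable_fun [set: T] g ->
  measurable [set s | g s <= f s - c%:E].
Proof.
move=> mf mg; rewrite -[X in measurable X]setTI.
by apply: measurable_lee => //; exact: emeasurable_funB.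
Qed.

Lemma measurable_le_cst g (c : \bar R) :
  measurable_fun [set: T] g -> measurable [set s | g s <= c].
Proof. by move=> mg; rewrite -[X in measurable X]setTI; exact: measurable_lee. Qed.

(** How large [K] has to be depends on [f] and [e] only: the lower bound with [S]
the tail set [B = {g <= -K}] gives
[K mu(B) <= - \int_B g <= e/2 + \int |f|], which makes [mu(B)] small enough for
the absolute continuity of the integral of [f]. *)
Lemma near_tail_ge f e : integrableT f -> (0 < e)%R ->
  \forall K \near pinfty_nbhs R, forall g, integrableT g ->
    (forall S, measurable S -> - (e / 2) <= rint g S - rint f S)%R ->
    (- e <= rint g [set s | (g s <= (- (K : R))%:E)%E])%R.
Proof.
move=> fi e0; have e20 : (0 < e / 2)%R by lra.
have [r r0 rP] := rint_abs_continuous fi e20.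
near=> K => g gi gf.
set B := [set s | _].
have mB : measurable B by apply: measurable_le_cst; exact: (measurable_int mu).
have K0 : (0 < K)%R by near: K; exact: nbhs_pinfty_gt.
have Kr : ((rint (abse \o f) setT + e / 2) / r < K)%R.
  by near: K; apply: nbhs_pinfty_gt; exact: num_real.
have gB : (rint g B <= 0 + - K * rmass B)%R.
  rewrite -(rint0 B); apply: rint_le_shift => //; first exact: integrable0.
  by move=> s Bs; rewrite add0e.
have gfB := gf _ mB.
have := rint_abs_le fi mB; rewrite ler_norml => /andP[fB _].
have fBT : (rint (abse \o f) B <= rint (abse \o f) setT)%R.
  exact: rint_abs_subset.
have : (rint (abse \o f) B < e / 2)%R.
  apply: rP => //; rewrite ltr_pdivrMr// in Kr.
  rewrite -(ltr_pM2l K0); lra.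
lra.
Unshelve. all: by end_near. Qed.

(** A lower bound of [\int_S g] by [\int_S f] that is uniform in [S]: with
[A = {g <= f - a}] and [B = {g <= -K}], one has [f <= g + a] on [S \ A],
[f <= |f|] on [A], [-K <= g] outside [B], and [g <= 0] on [B], so that enlarging
a subset of [B] to all of [B] can only decrease the integral of [g]. *)
Lemma rint_le_truncation f g S (a K : R) :
  integrableT f -> integrableT g -> measurable S -> (0 <= a)%R -> (0 <= K)%R ->
  (rint f S <= rint g S + a * rmass setT
    + rint (abse \o f) [set s | (g s <= f s - a%:E)%E]
    + K * rmass [set s | (g s <= f s - a%:E)%E]
    - rint g [set s | (g s <= (- K)%:E)%E])%R.
Proof.
move=> fi gi mS a0 K0; set A := [set s | _ <= f s - _]; set B := [set s | _].
have mA : measurable A by apply: measurable_le_shift; exact: (measurable_int mu).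
have mB : measurable B by apply: measurable_le_cst; exact: (measurable_int mu).
have mSA := measurableI _ _ mS mA; have mSDA := measurableD mS mA.
have mSAB := measurableI _ _ mSA mB; have mSADB := measurableD mSA mB.
have nonpos D : measurable D -> D `<=` B -> (rint g D <= 0)%R.
  move=> mD DB; have : (rint g D <= rint (cst 0) D + 0 * rmass D)%R.
    apply: rint_le_shift => //; first exact: integrable0.
    by move=> s /DB; rewrite /B/= add0e => /le_trans; apply; rewrite lee_fin; lra.
  by rewrite rint0 mul0r addr0.
have SDA : (rint f (S `\` A) <= rint g (S `\` A) + a * rmass setT)%R.
  have : (rint f (S `\` A) <= rint g (S `\` A) + a * rmass (S `\` A))%R.
    apply: rint_le_shift => // s [_ /negP]; rewrite -ltNge => /ltW.
    by rewrite leeBlDr.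
  by move/le_trans; apply; rewrite lerD2l ler_wpM2l// le_rmass.
have SA : (rint f (S `&` A) <= rint (abse \o f) A)%R.
  apply: le_trans (ler_norm _) _; apply: le_trans (rint_abs_le fi mSA) _.
  exact: rint_abs_subset.
have SADB : (0 <= rint g ((S `&` A) `\` B) + K * rmass A)%R.
  have : (rint (cst 0) (S `&` A `\` B) <=
          rint g (S `&` A `\` B) + K * rmass (S `&` A `\` B))%R.
    apply: rint_le_shift => //; first exact: integrable0.
    move=> s [_ /negP]; rewrite -ltNge => /ltW.
    by rewrite EFinN -sube_ge0// oppeK.
  rewrite rint0 => /le_trans; apply; rewrite lerD2l ler_wpM2l// le_rmass//.
  by move=> s [[]].
have SAB : (rint g B <= rint g ((S `&` A) `&` B))%R.
  rewrite (rint_setID gi mB mSA) setIC gerDl nonpos//.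
  exact: measurableD.
have := rint_setID fi mS mA; have := rint_setID gi mS mA.
have := rint_setID gi mSA mB; lra.
Qed.

(** * A subsequence with large lower limit *)

(** Borel-Cantelli: along indices [nk k] for which [fn (nk k) <= f - e k] has mass
less than [e k], with [e k] summable, almost every point lies in finitely many of
these sets, so [fn (nk k) > f - e k] there eventually. *)
Lemma lower_cvg_subseq f (fn : nat -> T -> \bar R) :
  measurable_fun [set: T] f -> (forall n, measurable_fun [set: T] (fn n)) ->
  lower_cvg_in_measure mu fn f -> has_subseq_liminf_ge mu fn f.
Proof.
move=> mf mfn fnf.
pose e k : R := (1 / (2 ^ k.+1)%:R)%R.
have e0 k : (0 < e k)%R by rewrite divr_gt0// ltr0n expn_gt0.
have /choice[N NP] : forall k, exists N, forall n, (N <= n)%N ->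
    mu [set s | fn n s <= f s - (e k)%:E] < (e k)%:E.
  move=> k; have /cvge0P/(_ _ (e0 k)) := fnf _ (e0 k).
  by case=> // N _ NP; exists N => n Nn; exact: NP.
(* The partial sums of [N + 1] increase strictly and dominate [N]. *)
pose nk k := (\sum_(i < k.+1) (N i).+1)%N.
have Nnk k : (N k <= nk k)%N by rewrite /nk big_ord_recr/= -addSnnS leq_addl.
exists nk; split.
  apply: (homo_ltn (r := fun a b => is_true (a < b)%N) ltn_trans) => k.
  by rewrite {2}/nk big_ord_recr/= addnS ltnS leq_addr.
pose F k := [set s | fn (nk k) s <= f s - (e k)%:E].
have mF k : measurable (F k) by exact: measurable_le_shift.
have F0 : mu (lim_sup_set F) = 0.
  apply: lim_sup_set_cvg0 => //.
  apply: (@le_lt_trans _ _ (\sum_(0 <= k <oo) (e k)%:E)).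
    by apply: lee_nneseries => // k _; apply: ltW; exact: NP.
  by apply: le_lt_trans (ltry (1 : R)); exact: epsilon_trick0.
exists (lim_sup_set F); split => //.
  by apply: bigcap_measurable => // k _; exact: bigcup_measurable.
move=> s /= sP; apply: contrapT => sF; apply: sP.
have [m mP] : exists m, forall k, (m <= k)%N -> f s - (e k)%:E < fn (nk k) s.
  apply: contrapT => noM; apply: sF => m _; apply: contrapT => Fm.
  apply: noM; exists m => k mk; rewrite ltNge; apply/negP => sk.
  by apply: Fm; exists k.
case: (f s) mP => [r mP|mP|_]; last exact: leNye.
  apply/(limf_einf_geP (fun k => fn (nk k) s) _ r) => c c0.
  near=> k; apply: le_trans (ltW (mP k _)).
    rewrite -EFinB lee_fin lerD2l lerN2; apply: ltW.
    near: k; have [M _ MP] := near_infty_natSinv_expn_lt (PosNum c0).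
    exists M => // k /= Mk; rewrite /e natrX.
    by apply: MP; exact: leq_trans (leqnSn k).
  by near: k; exists m.
(* Where [f s = +oo], nothing lies above [f s - e m = +oo]. *)
by have := mP m (leqnn m); rewrite addye// ltNge leey.
Unshelve. all: by end_near. Qed.

(** * Lower limits as uniform bounds *)

(** The two lower limits of the theorem are at least [0] exactly when these bounds
on real numbers hold, see [excess_liminfP] and [tail_liminfP]. *)
Definition uniform_excess f (fn : nat -> T -> \bar R) : Prop :=
  forall e : R, (0 < e)%R -> \forall n \near \oo, forall S, measurable S ->
    (- e <= rint (fn n) S - rint f S)%R.

Definition uniform_tails (fn : nat -> T -> \bar R) : Prop :=
  forall e : R, (0 < e)%R -> \forall K \near pinfty_nbhs R, forall n,
    (- e <= rint (fn n) [set s | (fn n s <= (- (K : R))%:E)%E])%R.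

Lemma excess_liminfP f (fn : nat -> T -> \bar R) :
  integrableT f -> (forall n, integrableT (fn n)) ->
  0 <= limn_einf (fun n : nat =>
         ereal_inf [set \int[mu]_(s in S) fn n s - \int[mu]_(s in S) f s
                   | S in (d.-measurable : set (set T))]) <->
  uniform_excess f fn.
Proof.
move=> fi fni; have intE n S : measurable S ->
    \int[mu]_(s in S) fn n s - \int[mu]_(s in S) f s
    = (rint (fn n) S - rint f S)%:E by move=> mS; rewrite !rintE.
apply: (iff_trans (limf_einf_geP _ (F := \oo) _ 0%R)).
split=> H e /H; apply: filterS => n; rewrite sub0r.
  by move=> /ereal_infP h S mS; rewrite -lee_fin -intE//; apply: h; exists S.
by move=> h; apply/ereal_infP => _ [S mS <-]; rewrite intE// lee_fin; exact: h.
Qed.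

Lemma tail_liminfP (fn : nat -> T -> \bar R) :
  (forall n, integrableT (fn n)) ->
  0 <= limf_einf (fun K : R =>
         ereal_inf [set \int[mu]_(s in [set s | fn n s <= (- K)%:E]) fn n s
                   | n in [set: nat]]) (pinfty_nbhs R) <->
  uniform_tails fn.
Proof.
move=> fni; have intE n (K : R) :
    \int[mu]_(s in [set s | fn n s <= (- K)%:E]) fn n s
    = (rint (fn n) [set s | (fn n s <= (- K)%:E)%E])%:E.
  by rewrite rintE//; apply: measurable_le_cst; exact: (measurable_int mu).
apply: (iff_trans (limf_einf_geP _ (F := pinfty_nbhs R) _ 0%R)).
split=> H e /H; apply: filterS => K; rewrite sub0r.
  by move=> /ereal_infP h n; rewrite -lee_fin -intE//; apply: h; exists n.
by move=> h; apply/ereal_infP => _ [n _ <-]; rewrite intE lee_fin; exact: h.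
Qed.

(** * The equivalence *)

Section uniform_lower_bound.
Variables (f : T -> \bar R) (fn : nat -> T -> \bar R).
Hypotheses (fi : integrableT f) (fni : forall n, integrableT (fn n)).

Lemma excess_lower_cvg : uniform_excess f fn -> lower_cvg_in_measure mu fn f.
Proof.
move=> ex e e0; apply/cvge0P => // h h0.
have eh0 : (0 < e * h / 2)%R by rewrite divr_gt0// mulr_gt0.
apply: filterS (ex _ eh0) => n exn; set A := [set s | _].
have mA : measurable A by apply: measurable_le_shift; exact: (measurable_int mu).
have : (rint (fn n) A <= rint f A + - e * rmass A)%R.
  by apply: rint_le_shift => // s; rewrite EFinN.
have := exn _ mA => ? ?; rewrite rmassE// lte_fin -(ltr_pM2l e0).
have : (0 < e * h)%R by rewrite mulr_gt0.
lra.
Qed.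

(** [near_tail_ge] treats the indices for which the lower bound holds; each of
the finitely many others is compared with itself, where the excess is [0]. *)
Lemma excess_tails : uniform_excess f fn -> uniform_tails fn.
Proof.
move=> ex e e0; have e20 : (0 < e / 2)%R by lra.
have [N _ NP] := ex _ e20.
have small : \forall K \near pinfty_nbhs R, forall i : 'I_N,
    (- e <= rint (fn i) [set s | (fn i s <= (- (K : R))%:E)%E])%R.
  apply: filter_forall => i.
  apply: filterS (near_tail_ge (fni i) e0) => K; apply => // S mS.
  by rewrite subrr; lra.
apply: filterS2 small (near_tail_ge fi e0) => K sK lK n.
have [nN|Nn] := ltnP n N; first exact: sK (Ordinal nN).
by apply: lK => // S mS; exact: NP.
Qed.

Lemma lower_cvg_tails_excess :
  lower_cvg_in_measure mu fn f -> uniform_tails fn -> uniform_excess f fn.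
Proof.
move=> fnf tails e e0; have e40 : (0 < e / 4)%R by lra.
have M0 := rmass_ge0 [set: T].
(* Adding [1] keeps the denominator positive when [mu] is zero. *)
pose a := (e / 4 / (rmass [set: T] + 1))%R.
have a0 : (0 < a)%R by rewrite divr_gt0//; lra.
have aM : (a * rmass [set: T] <= e / 4)%R.
  by rewrite /a mulrAC ler_pdivrMr ?ler_wpM2l//; lra.
have [K [K0 tailK]] : exists K : R, (0 < K)%R /\ forall n,
    (- (e / 4) <= rint (fn n) [set s | (fn n s <= (- K)%:E)%E])%R.
  apply: (@filter_ex _ (pinfty_nbhs R)).
  by apply: filterI (tails _ e40); exact: nbhs_pinfty_gt.
have [r r0 rP] := rint_abs_continuous fi e40.
have eK0 : (0 < e / 4 / K)%R by rewrite divr_gt0.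
have /cvge0P cvgA := fnf _ a0.
apply: filterS2 (cvgA _ _ r0) (cvgA _ _ eK0) => // n.
set A := [set s | _] => Ar AK S mS.
have mA : measurable A by apply: measurable_le_shift; exact: (measurable_int mu).
rewrite rmassE// lte_fin in Ar; rewrite rmassE// lte_fin ltr_pdivlMr// in AK.
(* The four error terms are [a mu(T)], the integral of [|f|] over [A],
   [K mu(A)] and the tail, each at most [e / 4]. *)
have := rint_le_truncation fi (fni n) mS (ltW a0) (ltW K0).
rewrite -/A; have := rP _ mA Ar; have := tailK n.
lra.
Qed.

End uniform_lower_bound.

End integrals_over_sets.

Theorem corollary1p4 (R : realType) (d : measure_display)
  (T : measurableType d) (mu : {finite_measure set T -> \bar R})
  (f : T -> \bar R) (fn : nat -> T -> \bar R)
  (f_int : mu.-integrable [set: T] f)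
  (fn_int : forall n : nat, mu.-integrable [set: T] (fn n)) :
  (0 <= limn_einf (fun n : nat =>
          ereal_inf [set \int[mu]_(s in S) fn n s - \int[mu]_(s in S) f s
                    | S in (d.-measurable : set (set T))])
   <->
   (lower_cvg_in_measure mu fn f /\ has_subseq_liminf_ge mu fn f) /\
   0 <= limf_einf (fun K : R =>
          ereal_inf [set \int[mu]_(s in [set s | fn n s <= (- K)%:E]) fn n s
                    | n in [set: nat]]) (pinfty_nbhs R))
  /\
  (lower_cvg_in_measure mu fn f -> has_subseq_liminf_ge mu fn f).
Proof.
have subseq : lower_cvg_in_measure mu fn f -> has_subseq_liminf_ge mu fn f.
  by apply: lower_cvg_subseq => [|n]; exact: (measurable_int mu).
split=> //; split.
- move=> /(excess_liminfP f_int fn_int) ex.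
  have fnf := excess_lower_cvg f_int fn_int ex.
  by split; [split=> //; exact: subseq|apply/tail_liminfP => //; exact: excess_tails ex].
- move=> [[fnf _] /(tail_liminfP fn_int) tails].
  by apply/excess_liminfP => //; exact: lower_cvg_tails_excess.
Qed.
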